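(* In each of the three settings (agents in $\mathbb{R}$; agents in $\mathbb{R}^2$ with the $L_1$ norm; agents in $\mathbb{R}^2$ with the $L_2$ norm), on any instance $I$ with $n$ agents whose preferred distances are bounded by $B$, the Median algorithm has social cost at most $OPT(I)+2nB$, i.e. $SC(\mathrm{med},I)\le OPT(I)+2nB$.
   Context: Let $\Omega=\mathbb{R}$ with the absolute value, or $\Omega=\mathbb{R}^2$ with the $L_1$ norm, or $\Omega=\mathbb{R}^2$ with the $L_2$ norm; write $\|\cdot\|$ for the norm. An instance with $n\ge1$ agents is a tuple $I=\langle (x_1,b_1),\dots,(x_n,b_n)\rangle$ with locations $x_i\in\Omega$ and preferred distances $b_i\in[0,B]$. The cost of agent $i$ when the facility is at $y\in\Omega$ is $cost(y,(x_i,b_i))=\big|\,\|x_i-y\|-b_i\,\big|$. The social cost is $SC(y,I)=\sum_i cost(y,(x_i,b_i))$ and $OPT(I)=\min_{y\in\Omega}SC(y,I)$. The Median algorithm places the facility at the location $\mathrm{med}$ defined as follows. In $\mathbb{R}$: $\mathrm{med}$ is the element of rank $\lfloor (n+1)/2\rfloor$ (in increasing order) among $x_1,\dots,x_n$. In $\mathbb{R}^2$ with $L_1$: each coordinate of $\mathrm{med}$ is the rank-$\lfloor (n+1)/2\rfloor$ element among the corresponding coordinates of the agents' locations. In $\mathbb{R}^2$ with $L_2$: $\mathrm{med}$ is a geometric median, i.e. a point minimizing $\sum_i\|x_i-y\|_2$ over $y\in\mathbb{R}^2$. *)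

(* Defs.v *)
From HB Require Import structures.
From mathcomp Require Export all_boot all_order all_algebra.
From mathcomp Require Export boolp classical_sets functions reals topology.
From mathcomp Require Export normedtype derive realfun sequences.
Export Order.TTheory GRing.Theory Num.Theory.
Export numFieldNormedType.Exports.

Set Implicit Arguments.
Unset Strict Implicit.
Unset Printing Implicit Defensive.


Local Open Scope classical_set_scope.
Local Open Scope ring_scope.

(* MathComp-Analysis equips 'rV[R]_2 with the sup norm, so the L1 and L2 norms
   are defined here and every notion below takes the norm N as an argument. *)
Definition l1norm (R : realType) (v : 'rV[R]_2) : R := \sum_(j < 2) `|v 0 j|.
Definition l2norm (R : realType) (v : 'rV[R]_2) : R :=
  Num.sqrt (\sum_(j < 2) v 0 j ^+ 2).

Definition absnorm (R : realType) (x : R) : R := `|x|.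

Section Facility.
Variables (R : realType) (T : zmodType) (N : T -> R) (n : nat).

(* The i-th agent is the pair (location, preferred distance). *)
Definition instance := n.-tuple (T * R).

Definition prefs_bounded (B : R) (I : instance) : Prop :=
  forall i, 0 <= (tnth I i).2 <= B.

Definition cost (y : T) (a : T * R) : R := `|N (a.1 - y) - a.2|.

Definition SC (y : T) (I : instance) : R := \sum_(i < n) cost y (tnth I i).

(* The infimum is a minimum in the three settings considered:
   see OPT_attained_line, OPT_attained_l1 and OPT_attained_l2. *)
Definition OPT (I : instance) : R := inf [set SC y I | y in [set: T]].

Definition geometric_median (m : T) (I : instance) : Prop :=
  forall y : T, \sum_(i < n) N ((tnth I i).1 - m)
             <= \sum_(i < n) N ((tnth I i).1 - y).

End Facility.

(* Ranks start at 1 and nth at 0, hence the predecessor. *)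
Definition rank_median (R : realType) (s : seq R) : R :=
  nth 0 (sort <=%R s) ((size s + 1) %/ 2).-1%N.

Definition med_line (R : realType) n (I : instance R R n) : R :=
  rank_median [seq a.1 | a <- I].

Definition med_l1 (R : realType) n (I : instance R 'rV[R]_2 n) : 'rV[R]_2 :=
  \row_j rank_median [seq a.1 0 j | a : 'rV[R]_2 * R <- I].

Section Attained.
Variable R : realType.

Lemma sum_continuous (T : topologicalType) n (F : 'I_n -> T -> R) :
  (forall i, continuous (F i)) -> continuous (fun x => \sum_(i < n) F i x).
Proof.
move=> cF; apply: continuous_big => [|i _]; [exact: add_continuous|exact: cF].
Qed.

Lemma SC_has_min (T : normedModType R) (N : T -> R) n (I : instance R T n) :
  continuous N -> (forall v, `|v| <= N v) ->
  (forall A : set T, bounded_set A -> closed A -> compact A) ->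
  (0 < n)%N -> exists y, forall z, SC N y I <= SC N z I.
Proof.
case: n I => // n I cN leN cpt _.
pose a := tnth I ord0; pose r := SC N a.1 I + `|a.2|.
have cSC : continuous (fun y => SC N y I).
  apply: sum_continuous => i y; rewrite /cost.
  apply: cvg_norm; apply: cvgB; last exact: cvg_cst.
  apply: (@cvg_comp _ _ _ (fun x => (tnth I i).1 - x) N); last exact: cN.
  by apply: cvgB; [exact: cvg_cst|exact: cvg_id].
have SC0 : 0 <= SC N a.1 I by apply: sumr_ge0 => i _; exact: normr_ge0.
pose A : set T := [set z | `|a.1 - z| <= r].
have A0 : A a.1 by rewrite /A /= subrr normr0 addr_ge0.
have cA : compact A.
  apply: cpt.
    exists (`|a.1| + r); split; first exact: num_real.
    move=> M ltM z /= Az; apply: le_trans (ltW ltM).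
    rewrite -[z](subKr a.1); apply: le_trans (ler_normB _ _) _.
    by rewrite lerD2l.
  apply: (@preimage_closed _ _ (fun z => `|a.1 - z|) [set t | t <= r]); last first.
    exact: closed_le.
  move=> z _; apply: cvg_norm; apply: cvgB; [exact: cvg_cst|exact: cvg_id].
have [|c _ cmin] := compact_EVT_min (ex_intro _ _ A0) cA (f := fun y => SC N y I).
  exact: continuous_subspaceT.
exists c => z; have [Az|] := boolP (`|a.1 - z| <= r).
  by apply: cmin; rewrite inE.
rewrite -ltNge => ltz; apply: le_trans (cmin a.1 _) _; first by rewrite inE.
apply: (@le_trans _ _ (cost N z a)).
  rewrite /cost; apply: le_trans (ler_norm _).
  rewrite lerBrDr; apply: le_trans (leN _); apply: le_trans (ltW ltz).
  by rewrite lerD2l ler_norm.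
rewrite /SC (bigD1 ord0) //= lerDl.
by apply: sumr_ge0 => i _; exact: normr_ge0.
Qed.

Lemma OPT_attained (T : zmodType) (N : T -> R) n (I : instance R T n) :
  (exists y, forall z, SC N y I <= SC N z I) ->
  exists y, SC N y I = OPT N I /\ forall z, OPT N I <= SC N z I.
Proof.
move=> [y miny]; suff -> : OPT N I = SC N y I by exists y.
apply/eqP; rewrite eq_le; apply/andP; split.
  by apply: ge_inf; [exists (SC N y I) => _ [z _ <-]|exists y].
by apply: lb_le_inf; [exists (SC N y I), y|move=> _ [z _ <-]].
Qed.

Lemma l1norm_continuous : continuous (@l1norm R).
Proof.
apply: sum_continuous => j v.
apply: (@continuous_comp _ _ _ (fun v : 'rV[R]_2 => v 0 j) (fun x : R => `|x|)).
  exact: coord_continuous.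
exact: norm_continuous.
Qed.

Lemma l2norm_continuous : continuous (@l2norm R).
Proof.
have cS : continuous (fun v : 'rV[R]_2 => \sum_(j < 2) v 0 j ^+ 2).
  apply: sum_continuous => j v.
  apply: (@continuous_comp _ _ _ (fun v : 'rV[R]_2 => v 0 j)
    (fun x : R => x ^+ 2)).
    exact: coord_continuous.
  exact: exprn_continuous.
move=> v; apply: (@continuous_comp _ _ _
  (fun v : 'rV[R]_2 => \sum_(j < 2) v 0 j ^+ 2) Num.sqrt).
  exact: cS.
exact: sqrt_continuous.
Qed.

Lemma norm_le_l1norm (v : 'rV[R]_2) : `|v| <= l1norm v.
Proof.
rewrite /Num.norm /= mx_normrE; apply: bigmax_le => [|[i j] _ /=].
  by apply: sumr_ge0.
rewrite ord1 /l1norm (bigD1 j) //= lerDl; exact: sumr_ge0.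
Qed.

Lemma norm_le_l2norm (v : 'rV[R]_2) : `|v| <= l2norm v.
Proof.
rewrite /Num.norm /= mx_normrE; apply: bigmax_le => [|[i j] _ /=].
  exact: sqrtr_ge0.
rewrite ord1 -sqrtr_sqr /l2norm ler_sqrt; last first.
  by apply: sumr_ge0 => k _; exact: sqr_ge0.
by rewrite (bigD1 j) //= lerDl; apply: sumr_ge0 => k _; exact: sqr_ge0.
Qed.

Context (n : nat) (n_gt0 : (0 < n)%N).

Lemma OPT_attained_line (I : instance R R n) :
  exists y, SC (@absnorm R) y I = OPT (@absnorm R) I
         /\ forall z, OPT (@absnorm R) I <= SC (@absnorm R) z I.
Proof.
apply: OPT_attained; apply: (@SC_has_min R) => //.
  by move=> x; exact: norm_continuous.
move=> A [M [_ bA]] cA.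
apply: (@subclosed_compact _ A `[- (M + 1), M + 1]) => //.
  exact: segment_compact.
have ltM : M < M + 1 by rewrite ltrDl.
by move=> x /(bA _ ltM); rewrite /= in_itv /= -ler_norml.
Qed.

Lemma OPT_attained_l1 (I : instance R 'rV[R]_2 n) :
  exists y, SC (@l1norm R) y I = OPT (@l1norm R) I
         /\ forall z, OPT (@l1norm R) I <= SC (@l1norm R) z I.
Proof.
apply: OPT_attained; apply: SC_has_min => //.
- exact: l1norm_continuous.
- exact: norm_le_l1norm.
- exact: bounded_closed_compact.
Qed.

Lemma l2_SC_has_min (I : instance R 'rV[R]_2 n) :
  exists y, forall z, SC (@l2norm R) y I <= SC (@l2norm R) z I.
Proof.
apply: SC_has_min => //.
- exact: l2norm_continuous.
- exact: norm_le_l2norm.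
- exact: bounded_closed_compact.
Qed.

Lemma OPT_attained_l2 (I : instance R 'rV[R]_2 n) :
  exists y, SC (@l2norm R) y I = OPT (@l2norm R) I
         /\ forall z, OPT (@l2norm R) I <= SC (@l2norm R) z I.
Proof. by apply: OPT_attained; exact: l2_SC_has_min. Qed.

Lemma geometric_median_exists (I : instance R 'rV[R]_2 n) :
  exists m, geometric_median (@l2norm R) m I.
Proof.
have [m minm] := l2_SC_has_min (map_tuple (fun a => (a.1, 0)) I).
have E y : SC (@l2norm R) y (map_tuple (fun a => (a.1, 0)) I)
         = \sum_(i < n) l2norm ((tnth I i).1 - y).
  apply: eq_bigr => i _; rewrite /cost tnth_map /= subr0 ger0_norm //.
  exact: sqrtr_ge0.
by exists m => y; rewrite -!E.
Qed.

End Attained.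

(* Main.v *)
Require Import Defs.
From mathcomp Require Import zify lra.

Local Open Scope ring_scope.

(** The cost [| ||x_i - y|| - b_i |] differs from the distance [||x_i - y||] by
    at most [b_i <= B].  The median minimizes the sum of the distances, and
    passing from costs to distances and back loses at most [n * B] each time. *)

Lemma SC_distance_minimizer (R : realType) (T : zmodType) (N : T -> R) (n : nat)
    (B : R) (I : instance R T n) (m : T) :
  (forall v, 0 <= N v) -> prefs_bounded B I -> geometric_median N m I ->
  SC N m I <= OPT N I + 2 * n%:R * B.
Proof.
move=> N_ge0 Bbound mmin.
have sumB : \sum_(i < n) B = n%:R * B.
  by rewrite sumr_const card_ord mulr_natl.
(* As [OPT] is an infimum, it suffices to compare with the cost at an arbitrary [y]. *)
rewrite -lerBlDr; apply: lb_le_inf; first by exists (SC N m I), m.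
move=> _ [y _ <-]; rewrite lerBlDr.
have le_m : SC N m I <= \sum_(i < n) N ((tnth I i).1 - m) + n%:R * B.
  rewrite -sumB -big_split /=; apply: ler_sum => i _; rewrite /cost.
  have /andP[b_ge0 b_le] := Bbound i.
  (* With [d] the distance, [d - b <= d + B] needs [0 <= b <= B], and [b - d <= d + B] needs
     [0 <= d] and [b <= B]. *)
  by rewrite ler_norml; have := N_ge0 ((tnth I i).1 - m); lra.
have ge_y : \sum_(i < n) N ((tnth I i).1 - y) <= SC N y I + n%:R * B.
  rewrite -sumB -big_split /=; apply: ler_sum => i _; rewrite /cost.
  have /andP[_ b_le] := Bbound i.
  by have := ler_norm (N ((tnth I i).1 - y) - (tnth I i).2); lra.
by have := mmin y; lra.
Qed.

(** The left side equals [b - a], which the triangle inequality bounds by the right side. *)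
Lemma ler_distD_between (R : realDomainType) (a b m y : R) :
  a <= m <= b -> `|a - m| + `|b - m| <= `|a - y| + `|b - y|.
Proof.
move=> /andP[am mb].
rewrite (distrC a m) (distrC a y) (@ger0_norm _ (m - a)) ?subr_ge0//.
rewrite (@ger0_norm _ (b - m)) ?subr_ge0//.
by have := ler_norm (y - a); have := ler_norm (b - y); lra.
Qed.

(* In sorted order, pair the element of index [i] with that of index
   [size s - i - 1]: the median lies between the two, hence minimizes the sum
   of the distances to them. *)
Lemma rank_median_min (R : realType) (s : seq R) (y : R) :
  \sum_(x <- s) `|x - rank_median s| <= \sum_(x <- s) `|x - y|.
Proof.
have szt : size (sort <=%R s) = size s by rewrite size_sort.
have t_sorted : sorted <=%R (sort <=%R s) by exact/sort_sorted/le_total.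
have sumE z : \sum_(x <- s) `|x - z|
    = \sum_(0 <= i < size s) `|nth 0 (sort <=%R s) i - z|.
  by rewrite -(perm_big _ (permEl (perm_sort <=%R s))) (big_nth 0) szt.
rewrite sumE {}sumE /rank_median.
move: (sort _ _) (size s) szt t_sorted => t k szt t_sorted.
have t_mono i j : (i <= j < k)%N -> t`_i <= t`_j.
  move=> /andP[ij jk]; apply: sorted_leq_nth => //; first exact: le_trans.
  - by rewrite inE szt; lia.
  - by rewrite inE szt.
(* Doubling the sum avoids a parity split: for odd [k] the middle index is paired with itself. *)
have pairE z : (\sum_(0 <= i < k) `|t`_i - z|) *+ 2
    = \sum_(0 <= i < k) (`|t`_i - z| + `|t`_(k - i.+1) - z|).
  by rewrite mulr2n {2}big_nat_rev -big_split.
rewrite -(ler_pMn2r (ltn0Sn 1)) !pairE !big_nat; apply: ler_sum => i ik.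
(* The 0-based median index is the floor of [(k - 1) / 2], so it lies between [i] and [k - i.+1] in
   either order. *)
have [le_i|lt_i] := leqP i (k - i.+1).
  by apply: ler_distD_between; rewrite !t_mono//; lia.
rewrite addrC [leRHS]addrC.
by apply: ler_distD_between; rewrite !t_mono//; lia.
Qed.

(** The projection [f] is the location on the line, and a single coordinate in the plane. *)
Lemma rank_median_map_min (R : realType) (A : Type) (n : nat) (f : A -> R)
    (I : n.-tuple A) (y : R) :
  \sum_(i < n) `|f (tnth I i) - rank_median [seq f a | a <- I]|
    <= \sum_(i < n) `|f (tnth I i) - y|.
Proof.
have sumE z : \sum_(i < n) `|f (tnth I i) - z|
    = \sum_(x <- [seq f a | a <- I]) `|x - z|.
  by rewrite big_map big_tuple.
by rewrite !sumE rank_median_min.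
Qed.

Lemma med_line_min (R : realType) (n : nat) (I : instance R R n) :
  geometric_median (@absnorm R) (med_line I) I.
Proof. by move=> y; exact: rank_median_map_min. Qed.

(** The sum of L1 distances separates into one problem on the line per coordinate. *)
Lemma med_l1_min (R : realType) (n : nat) (I : instance R 'rV[R]_2 n) :
  geometric_median (@l1norm R) (med_l1 I) I.
Proof.
move=> y; rewrite /l1norm exchange_big [leRHS]exchange_big /=.
apply: ler_sum => j _; under eq_bigr do rewrite !mxE.
under [leRHS]eq_bigr do rewrite !mxE.
exact: (rank_median_map_min _ _ _ (fun a : 'rV[R]_2 * R => a.1 0 j)).
Qed.

Theorem theorem3 (R : realType) (n : nat) (B : R) (n_gt0 : (0 < n)%N) :
  [/\ forall I : instance R R n, prefs_bounded B I ->
        SC (@absnorm R) (med_line I) I <= OPT (@absnorm R) I + 2 * n%:R * B,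
      forall I : instance R 'rV[R]_2 n, prefs_bounded B I ->
        SC (@l1norm R) (med_l1 I) I <= OPT (@l1norm R) I + 2 * n%:R * B
    & forall (I : instance R 'rV[R]_2 n) (med : 'rV[R]_2),
        prefs_bounded B I -> geometric_median (@l2norm R) med I ->
        SC (@l2norm R) med I <= OPT (@l2norm R) I + 2 * n%:R * B].
Proof.
split=> [I IB|I IB|I med IB med_min]; apply: SC_distance_minimizer => //.
- by move=> v; exact: normr_ge0.
- exact: med_line_min.
- by move=> v; apply: sumr_ge0.
- exact: med_l1_min.
- by move=> v; exact: sqrtr_ge0.
Qed.
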